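(* For any two distinct nonzero $j,k\in(\mathbb{Z}/2)^3$, $$e_j\times e_k=\varepsilon(j,k)\,e_{j+k},$$ where $\varepsilon(j,k)\in\{+1,-1\}$ is the sign coming from the cross product $\times$ on $\mathbb{R}^7$. (In other words, $e_j\times e_k=\pm e_{j+k}$ for all distinct nonzero $j,k$.)
   Context: Let $\{e_1,\dots,e_7\}$ be the standard orthonormal basis of $\mathbb{R}^7$ with Euclidean inner product $\langle\cdot,\cdot\rangle$, dual basis $\omega^1,\dots,\omega^7$, and $\omega^{ijk}=\omega^i\wedge\omega^j\wedge\omega^k$. Let $$\Phi=\omega^{123}+\omega^{145}+\omega^{167}+\omega^{246}-\omega^{257}-\omega^{347}-\omega^{356},$$ and let $\times$ be the bilinear cross product on $\mathbb{R}^7$ characterized by $\langle u\times v,w\rangle=\Phi(u,v,w)$ for all $u,v,w$. The basis vectors (equivalently the indices $1,\dots,7$) are labeled by the nonzero elements of $(\mathbb{Z}/2)^3$ via $1\leftrightarrow(1,0,0)$, $2\leftrightarrow(0,1,0)$, $3\leftrightarrow(1,1,0)$, $4\leftrightarrow(0,0,1)$, $5\leftrightarrow(1,0,1)$, $6\leftrightarrow(0,1,1)$, $7\leftrightarrow(1,1,1)$. Indices are identified with their images, and $+$ denotes addition in $(\mathbb{Z}/2)^3$. *)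

(* Defs.v *)
From mathcomp Require Import all_boot all_order all_algebra.
From mathcomp Require Import reals.
From mathcomp Require Import ring.

Set Implicit Arguments.
Unset Strict Implicit.
Unset Printing Implicit Defensive.

Import Order.TTheory GRing.Theory Num.Theory.
Local Open Scope ring_scope.

Definition dot (R : realType) (u v : 'rV[R]_7) : R := \sum_i u 0 i * v 0 i.

(* 'I_7 counts from 0, so the index i of the text (1 <= i <= 7) is the ordinal
   of value i - 1. *)
Definition omega (R : realType) (i : nat) (u : 'rV[R]_7) : R :=
  u 0 (inord i.-1).

(* Determinant normalization of the wedge product of three covectors, without
   a factor 1/3!, so that omega3 i j k e_i e_j e_k = 1 for distinct i, j, k. *)
Definition wedge3 (R : realType) (a b c : 'rV[R]_7 -> R) (u v w : 'rV[R]_7) :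
    R :=
  \det (\matrix_(p < 3, q < 3)
          (nth a [:: a; b; c] q) (nth u [:: u; v; w] p)).

Definition omega3 (R : realType) (i j k : nat) :
    'rV[R]_7 -> 'rV[R]_7 -> 'rV[R]_7 -> R :=
  wedge3 (@omega R i) (@omega R j) (@omega R k).

Definition Phi (R : realType) (u v w : 'rV[R]_7) : R :=
  omega3 1 2 3 u v w + omega3 1 4 5 u v w + omega3 1 6 7 u v w
  + omega3 2 4 6 u v w - omega3 2 5 7 u v w
  - omega3 3 4 7 u v w - omega3 3 5 6 u v w.

(* The vector representing the linear form Phi u v; dot_cross and cross_unique
   show that it is the product characterized by <u x v, w> = Phi(u, v, w). *)
Definition cross (R : realType) (u v : 'rV[R]_7) : 'rV[R]_7 :=
  \row_k Phi u v (delta_mx 0 k).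

Notation Z23 := ('Z_2 * 'Z_2 * 'Z_2)%type.

Definition label (i : 'I_7) : Z23 :=
  nth 0 [:: (1, 0, 0); (0, 1, 0); (1, 1, 0); (0, 0, 1);
            (1, 0, 1); (0, 1, 1); (1, 1, 1)] i.

(* The standard basis vector whose index has label j (see e_label and
   label_onto); the unused value e 0 is the zero vector. *)
Definition e (R : realType) (j : Z23) : 'rV[R]_7 := \row_i (label i == j)%:R.

Lemma label_neq0 (i : 'I_7) : label i != 0.
Proof. by case: i => [[|[|[|[|[|[|[|i]]]]]]] lti]. Qed.

Lemma label_inj : injective label.
Proof.
move=> [[|[|[|[|[|[|[|i]]]]]]] lti] [[|[|[|[|[|[|[|j]]]]]]] ltj] //= /eqP;
  by [move=> _; apply: val_inj | rewrite /label /=].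
Qed.

Lemma label_onto (j : Z23) : j != 0 -> exists i, label i = j.
Proof.
case: j => [[[[|[|a]] lta] [[|[|b]] ltb]] [[|[|c]] ltc]] // nz;
  by [case/negP: nz
     | exists (inord 0); apply/eqP; rewrite /label inordK
     | exists (inord 1); apply/eqP; rewrite /label inordK
     | exists (inord 2); apply/eqP; rewrite /label inordK
     | exists (inord 3); apply/eqP; rewrite /label inordK
     | exists (inord 4); apply/eqP; rewrite /label inordK
     | exists (inord 5); apply/eqP; rewrite /label inordK
     | exists (inord 6); apply/eqP; rewrite /label inordK].
Qed.

Lemma e_label (R : realType) (i : 'I_7) : e R (label i) = delta_mx 0 i.
Proof. by apply/rowP => k; rewrite !mxE (inj_eq label_inj). Qed.

Lemma wedge3E (R : realType) (a b c : 'rV[R]_7 -> R) (u v w : 'rV[R]_7) :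
  wedge3 a b c u v w =
    a u * (b v * c w - c v * b w) - b u * (a v * c w - c v * a w)
    + c u * (a v * b w - b v * a w).
Proof.
rewrite /wedge3 (expand_det_row _ ord0) !big_ord_recl big_ord0 addr0.
rewrite /cofactor !(expand_det_row _ ord0) !big_ord_recl !big_ord0.
by rewrite /cofactor !det_mx11 !mxE /=; ring.
Qed.

Lemma Phi_linear_l (R : realType) (v w : 'rV[R]_7) :
  scalar (fun u => Phi u v w).
Proof.
by move=> a u u'; rewrite /Phi /omega3 !wedge3E /omega !mxE; ring.
Qed.

Lemma Phi_linear_m (R : realType) (u w : 'rV[R]_7) :
  scalar (fun v => Phi u v w).
Proof.
by move=> a v v'; rewrite /Phi /omega3 !wedge3E /omega !mxE; ring.
Qed.

Lemma Phi_linear_r (R : realType) (u v : 'rV[R]_7) : scalar (Phi u v).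
Proof.
by move=> a w w'; rewrite /Phi /omega3 !wedge3E /omega !mxE; ring.
Qed.

Lemma cross_linear_l (R : realType) (v : 'rV[R]_7) :
  linear (fun u => cross u v).
Proof. by move=> a u u'; apply/rowP => k; rewrite !mxE Phi_linear_l. Qed.

Lemma cross_linear_r (R : realType) (u : 'rV[R]_7) : linear (cross u).
Proof. by move=> a v v'; apply/rowP => k; rewrite !mxE Phi_linear_m. Qed.

Lemma dot_cross (R : realType) (u v w : 'rV[R]_7) :
  dot (cross u v) w = Phi u v w.
Proof.
have Phi0 : Phi u v 0 = 0.
  by have := Phi_linear_r u v (-1) 0 0; rewrite scaler0 addr0 mulN1r addNr.
have PhiD x y : Phi u v (x + y) = Phi u v x + Phi u v y.
  by rewrite -[x]scale1r Phi_linear_r mul1r scale1r.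
have PhiZ a x : Phi u v (a *: x) = a * Phi u v x.
  by rewrite -[a *: x]addr0 Phi_linear_r Phi0 addr0.
rewrite [w in RHS]row_sum_delta (big_morph _ PhiD Phi0).
by apply: eq_bigr => k _; rewrite mxE PhiZ mulrC.
Qed.

Lemma cross_unique (R : realType) (f : 'rV[R]_7 -> 'rV[R]_7 -> 'rV[R]_7) :
  (forall u v w, dot (f u v) w = Phi u v w) ->
  forall u v, f u v = cross u v.
Proof.
move=> fP u v; apply/rowP => k; rewrite mxE -fP /dot (bigD1 k) //=.
rewrite !mxE !eqxx mulr1 big1 ?addr0 // => i ik.
by rewrite mxE (negbTE ik) andbF mulr0.
Qed.

(* Main.v *)
Require Import Defs.
From mathcomp Require Import all_boot all_order all_algebra.
From mathcomp Require Import reals.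
Local Open Scope ring_scope.

(** The seven triples [ijk] occurring in [Phi] are the lines of the Fano
    plane: the labels of each triple add up to 0 in (Z/2)^3, and two distinct
    points lie on exactly one line, whose third point is their sum.  Hence, for
    distinct nonzero [j] and [k], the number [Phi (e j) (e k) (e l)] can be
    nonzero only for [l = j + k], where a single monomial of [Phi] contributes,
    with value 1 or -1.  These numbers are the coordinates of
    [cross (e j) (e k)], and the sign is [Phi (e j) (e k) (e (j + k))].

    On basis vectors [Phi] takes integer values which do not depend on the
    field ([Phi_e]), so that the incidence property above is a finite statement
    about integers, decided by evaluation ([Phi_int_line]). *)

Import GRing.Theory.

Definition labels : seq Z23 :=
  [:: (1, 0, 0); (0, 1, 0); (1, 1, 0); (0, 0, 1);
      (1, 0, 1); (0, 1, 1); (1, 1, 1)].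

Definition omega_int (i : nat) (j : Z23) : int :=
  Posz (nth 0 labels i.-1 == j).

Definition omega3_int (a b c : nat) (j k l : Z23) : int :=
  omega_int a j * (omega_int b k * omega_int c l - omega_int c k * omega_int b l)
  - omega_int b j * (omega_int a k * omega_int c l - omega_int c k * omega_int a l)
  + omega_int c j * (omega_int a k * omega_int b l - omega_int b k * omega_int a l).

Definition Phi_int (j k l : Z23) : int :=
  omega3_int 1 2 3 j k l + omega3_int 1 4 5 j k l + omega3_int 1 6 7 j k l
  + omega3_int 2 4 6 j k l - omega3_int 2 5 7 j k l
  - omega3_int 3 4 7 j k l - omega3_int 3 5 6 j k l.

Lemma mem_labels (j : Z23) : j != 0 -> j \in labels.
Proof. by case/label_onto => i <-; apply: mem_nth. Qed.

Lemma omega_e (R : realType) (i : nat) (j : Z23) :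
  (i.-1 < 7)%N -> omega i (e R j) = (omega_int i j)%:~R.
Proof. by move=> lti; rewrite /omega mxE /label inordK. Qed.

Lemma omega3_e (R : realType) (a b c : nat) (j k l : Z23) :
  (a.-1 < 7)%N -> (b.-1 < 7)%N -> (c.-1 < 7)%N ->
  omega3 a b c (e R j) (e R k) (e R l) = (omega3_int a b c j k l)%:~R.
Proof.
move=> lta ltb ltc; rewrite /omega3 wedge3E !omega_e //.
by rewrite /omega3_int !(rmorphD, rmorphN, rmorphM).
Qed.

Lemma Phi_e (R : realType) (j k l : Z23) :
  Phi (e R j) (e R k) (e R l) = (Phi_int j k l)%:~R.
Proof.
rewrite /Phi !omega3_e; try exact: isT.
rewrite /Phi_int.
(* Abstracting the monomials keeps unification from expanding the 3 x 3
   determinants below. *)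
do 7! move: (omega3_int _ _ _ _ _ _) => ?.
by rewrite !(intrD, mulrNz).
Qed.

(** This is the incidence geometry of the Fano plane together with the
    signs of [Phi]; it ranges over the list [labels] rather than over a finite
    type because enumerations of finite types do not evaluate. *)
Lemma Phi_int_line (j k l : Z23) :
  j \in labels -> k \in labels -> l \in labels -> j != k ->
  if l == j + k then (Phi_int j k l == 1) || (Phi_int j k l == -1)
  else Phi_int j k l == 0.
Proof.
have table : all (fun j => all (fun k => all (fun l => (j != k) ==>
    if l == j + k then (Phi_int j k l == 1) || (Phi_int j k l == -1)
    else Phi_int j k l == 0) labels) labels) labels.
  by vm_compute.
move=> jL kL lL.
by move/allP: table => /(_ j jL) /allP/(_ k kL) /allP/(_ l lL) /implyP.
Qed.

Lemma addZ23_neq0 (j k : Z23) : j != k -> j + k != 0.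
Proof.
have oppZ23 : - k = k.
  have oppZ2 (a : 'Z_2) : - a = a by apply/eqP; move: a => [[|[|]]].
  by case: k => [[a b] c]; congr (_, _, _); apply: oppZ2.
by rewrite -{2}oppZ23 subr_eq0.
Qed.

Theorem theorem4p1 (R : realType) :
  exists epsilon : Z23 -> Z23 -> R,
    forall j k : Z23, j != 0 -> k != 0 -> j != k ->
      (epsilon j k = 1 \/ epsilon j k = -1) /\
      cross (e R j) (e R k) = epsilon j k *: e R (j + k).
Proof.
exists (fun j k => (Phi_int j k (j + k))%:~R) => j k.
move=> /mem_labels jL /mem_labels kL neq_jk; split.
  have := Phi_int_line _ _ _ jL kL (mem_labels _ (addZ23_neq0 _ _ neq_jk)) neq_jk.
  by rewrite eqxx => /orP[] /eqP ->; [left | right; rewrite rmorphN].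
apply/rowP => i; rewrite !mxE -e_label Phi_e.
have := Phi_int_line _ _ _ jL kL (mem_labels _ (label_neq0 i)) neq_jk.
by case: eqP => [-> | _ /eqP ->]; rewrite ?mulr1 ?mulr0.
Qed.
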